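(* Let $r\ge 2$, let $W_r$ be the Weyl group of the simple Lie algebra $\mathfrak{sp}_{2r}(\mathbb C)$ of type $C_r$, and let $\mathcal C_r=\{\sigma\in W_r:\wp(\sigma(\tilde\alpha+\rho)-\rho)>0\}$, where $\tilde\alpha$ is the highest root. Let $\sigma\in W_r$. Then $\sigma\in\mathcal C_r$ if and only if $\sigma$ is a product of commuting basic allowable subwords of Type $C$.
   Context: Type $C_r$: simple roots $\alpha_i=\varepsilon_i-\varepsilon_{i+1}$ for $1\le i\le r-1$ and $\alpha_r=2\varepsilon_r$; positive roots $\Phi^+=\{\varepsilon_i-\varepsilon_j,\varepsilon_i+\varepsilon_j:1\le i<j\le r\}\cup\{2\varepsilon_i:1\le i\le r\}$; highest root $\tilde\alpha=2\alpha_1+2\alpha_2+\cdots+2\alpha_{r-1}+\alpha_r$ $(=2\varepsilon_1)$; $\rho=\frac12\sum_{\alpha\in\Phi^+}\alpha$. $s_i$ denotes the simple reflection in $\alpha_i$, and $W_r$ is the Weyl group generated by $s_1,\dots,s_r$. $\wp(\xi)$ is Kostant's partition function: the number of ways $\xi$ may be written as a nonnegative integral sum of positive roots. The basic allowable subwords of Type $C$ are the following elements of $W_r$ (products act as compositions of maps, e.g. $s_is_j(v)=s_i(s_j(v))$): the identity $1$; $s_i$ for $2\le i\le r$; $s_is_{i+1}$ for $2\le i\le r-2$; $s_{i+1}s_i$ for $2\le i\le r-2$; $s_is_{i+1}s_i$ for $2\le i\le r-2$; $s_is_{i+2}s_{i+1}$ for $2\le i\le r-3$ (an index range that is empty contributes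 nothing). A product of commuting basic allowable subwords is an element $\sigma=w_1w_2\cdots w_k$ ($k\ge 1$) where each $w_a$ is a basic allowable subword and, for $a\ne b$, every simple reflection occurring in $w_a$ is different from and commutes with every simple reflection occurring in $w_b$. *)

(* Defs.v *)
From HB Require Import structures.
From mathcomp Require Import all_boot all_order all_algebra finmap zify.
From mathcomp Require Import boolp classical_sets functions cardinality.

Set Implicit Arguments.
Unset Strict Implicit.
Unset Printing Implicit Defensive.

Import Order.TTheory GRing.Theory Num.Theory.

Local Open Scope ring_scope.

(* The root system of type C_r is realized in Q^r (column vectors), on which
   matrices act from the left, so that *m is the composition of maps.
   Roots and reflections carry the usual 1-based indices, as elements of nat:
   eps r i is only meaningful for 1 <= i <= r. *)
Definition eps (r i : nat) : 'cV[rat]_r := \col_(j < r) (j.+1 == i)%:R.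

Definition simple_root (r i : nat) : 'cV[rat]_r :=
  if (i < r)%N then eps r i - eps r i.+1 else 2 *: eps r r.

Definition pos_roots (r : nat) : seq 'cV[rat]_r :=
  [seq eps r i - eps r j | i <- index_iota 1 r.+1, j <- index_iota i.+1 r.+1]
  ++ [seq eps r i + eps r j | i <- index_iota 1 r.+1, j <- index_iota i.+1 r.+1]
  ++ [seq 2 *: eps r i | i <- index_iota 1 r.+1].

Definition highest_root (r : nat) : 'cV[rat]_r :=
  (\sum_(1 <= i < r) 2 *: simple_root r i) + simple_root r r.

Definition rho (r : nat) : 'cV[rat]_r := 2^-1 *: \sum_(a <- pos_roots r) a.

Definition dot (r : nat) (u v : 'cV[rat]_r) : rat := \sum_(i < r) u i 0 * v i 0.

Definition reflection (r : nat) (a : 'cV[rat]_r) : 'M[rat]_r :=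
  1%:M - (2 / dot a a) *: (a *m a^T).

Lemma reflectionE (r : nat) (a v : 'cV[rat]_r) :
  reflection a *m v = v - (2 * dot v a / dot a a) *: a.
Proof.
rewrite /reflection mulmxBl mul1mx -scalemxAl -mulmxA; congr (_ - _).
have -> : a^T *m v = (dot v a)%:M.
  apply/matrixP=> i j; rewrite !ord1 !mxE /= mulr1n.
  by apply: eq_bigr => k _; rewrite mxE mulrC.
by rewrite mul_mx_scalar scalerA mulrAC.
Qed.

Definition simple_reflection (r i : nat) : 'M[rat]_r :=
  reflection (simple_root r i).

Inductive weyl (r : nat) : 'M[rat]_r -> Prop :=
  | weyl_gen i : (1 <= i <= r)%N -> weyl (simple_reflection r i)
  | weyl_one : weyl 1%:M
  | weyl_mul s t : weyl s -> weyl t -> weyl (s *m t)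
  | weyl_inv s : weyl s -> weyl (invmx s).

(* The ways to write xi as a nonnegative integral sum of positive roots are
   the multiplicity functions m on the set of positive roots with
   \sum_a m(a) a = xi. *)
Definition kostant_ways (r : nat) (xi : 'cV[rat]_r) :
    set {ffun seq_sub (pos_roots r) -> nat} :=
  [set m : {ffun seq_sub (pos_roots r) -> nat} | \sum_a val a *+ m a = xi]%classic.

(* fset_set is the empty set on infinite sets, whence kostant_ways_finite. *)
Definition kostant (r : nat) (xi : 'cV[rat]_r) : nat :=
  #|` fset_set (kostant_ways xi)|%fset.


Section Finiteness.
Variable r : nat.

Let ht (v : 'cV[rat]_r) : rat := \sum_(j < r) (r - j)%:R * v j 0.

Let htD u v : ht (u + v) = ht u + ht v.
Proof. by rewrite -big_split; apply: eq_bigr => j _; rewrite mxE mulrDr. Qed.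

Let htZ c v : ht (c *: v) = c * ht v.
Proof. by rewrite mulr_sumr; apply: eq_bigr => j _; rewrite mxE mulrCA. Qed.

Let ht_eps i : (1 <= i <= r)%N -> ht (eps r i) = (r.+1 - i)%:R.
Proof.
case: i => // i /= ir; rewrite /ht (bigD1 (Ordinal ir)) //= mxE eqxx mulr1 big1.
  by rewrite addr0 subSS.
by move=> j; rewrite mxE eqSS -val_eqE /= => /negPf ->; rewrite mulr0.
Qed.

Let ht_pos a : a \in pos_roots r -> 1 <= ht a.
Proof.
rewrite !mem_cat => /or3P[/allpairsPdep[i [j []]]|/allpairsPdep[i [j []]]|/mapP[i]];
  rewrite !mem_index_iota ?ltnS.
- move=> ir jr ->; rewrite -scaleN1r htD htZ !ht_eps; [|by lia..].
  rewrite mulN1r -natrB; last by lia.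
  by rewrite ler1n; lia.
- move=> ir jr ->; rewrite htD !ht_eps; [|by lia..].
  by rewrite -natrD ler1n; lia.
- move=> ir ->; rewrite htZ ht_eps; last by lia.
  by rewrite -natrM ler1n; lia.
Qed.

Lemma kostant_ways_finite (xi : 'cV[rat]_r) : finite_set (kostant_ways xi).
Proof.
have [N hN] : exists N : nat, ht xi <= N%:R.
  exists (Num.bound `|ht xi|).
  exact: le_trans (ler_norm _) (ltW (archi_boundP (normr_ge0 _))).
pose F (f : {ffun seq_sub (pos_roots r) -> 'I_N.+1}) :
  {ffun seq_sub (pos_roots r) -> nat} := [ffun a => val (f a)].
apply: (@sub_finite_set _ _ (F @` [set: _])%classic); last first.
  by apply: finite_image; apply: finite_finset.
move=> m /= hm; exists [ffun a => inord (m a)] => //.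
apply/ffunP => a; rewrite !ffunE /= inordK // ltnS -(ler_nat rat).
apply: le_trans hN; rewrite -hm (bigD1 a) //= htD.
have htn b : (m b)%:R <= ht (val b *+ m b).
  by rewrite -scaler_nat htZ ler_peMr ?ler0n// ht_pos// ssvalP.
rewrite -[leLHS]addr0 lerD ?htn //.
apply: (big_ind (fun v => 0 <= ht v)) => [||b _].
- by rewrite -(scale0r 0) htZ mul0r.
- by move=> u v hu hv; rewrite htD addr_ge0.
- by apply: le_trans (htn b); rewrite ler0n.
Qed.

End Finiteness.

Definition weyl_alternation_set (r : nat) (sigma : 'M[rat]_r) : Prop :=
  weyl sigma /\
  (0 < kostant (sigma *m (highest_root r + rho r) - rho r))%N.

(* Subwords are kept as words in the indices of the simple reflections, so
   that "occurring in" is literal membership. *)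
Definition word_elt (r : nat) (w : seq nat) : 'M[rat]_r :=
  \big[mulmx/1%:M]_(i <- w) simple_reflection r i.

Inductive basic_allowable (r : nat) : seq nat -> Prop :=
  | bas_id : basic_allowable r [::]
  | bas_s i : (2 <= i)%N -> (i <= r)%N -> basic_allowable r [:: i]
  | bas_su i : (2 <= i)%N -> (i + 2 <= r)%N -> basic_allowable r [:: i; i.+1]
  | bas_us i : (2 <= i)%N -> (i + 2 <= r)%N -> basic_allowable r [:: i.+1; i]
  | bas_sus i : (2 <= i)%N -> (i + 2 <= r)%N ->
      basic_allowable r [:: i; i.+1; i]
  | bas_stu i : (2 <= i)%N -> (i + 3 <= r)%N ->
      basic_allowable r [:: i; i.+2; i.+1].

Definition commuting_words (r : nat) (u v : seq nat) : Prop :=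
  forall i j : nat, i \in u -> j \in v ->
    simple_reflection r i != simple_reflection r j /\
    comm_mx (simple_reflection r i) (simple_reflection r j).

Definition commuting_bas_product (r : nat) (sigma : 'M[rat]_r) : Prop :=
  exists (k : nat) (w : 'I_k -> seq nat),
    [/\ (1 <= k)%N,
        forall a, basic_allowable r (w a),
        forall a b, a != b -> commuting_words r (w a) (w b) &
        sigma = \big[mulmx/1%:M]_(a < k) word_elt r (w a)].

(* Main.v *)
Require Import Defs.
From mathcomp Require Import all_boot all_order all_algebra.
From mathcomp Require Import finmap zify ring boolp classical_sets cardinality.

(** Put lambda = highest_root + rho; its coordinates are
    (r + 2, r - 1, r - 2, ..., 1), while those of rho are (r, r - 1, ..., 1).

    A product of commuting basic subwords belongs to the alternation set
    because a basic subword w changes lambda by a sum of simple roots alpha_i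
    with i in w, in which each root occurs at most as often as in the highest
    root 2 alpha_1 + ... + 2 alpha_(r-1) + alpha_r (basic_allowable_lowering).
    Distinct commuting reflections have orthogonal roots
    (commuting_reflection_fix), so the factors of a product do not disturb
    each other and their effects add up (commuting_product_lowering).
    Hence sigma lambda - rho is still a sum of simple roots.

    Conversely, the Weyl group acts by signed permutations, and if the
    partition function is positive at sigma lambda - rho then all partial sums
    of coordinates of this vector are nonnegative. The first of them forces
    sigma lambda to begin with r + 2; the others say that the remaining
    entries, a signed arrangement of r - 1, ..., 1, have partial sums at most 2
    below those of the decreasing arrangement (kostant_gt0_small_deficit).
    Cut this arrangement at the positions where this deficit is 0. Listing the
    values that can follow each other without exceeding the deficit 2 shows
    that there are only seven kinds of blocks, of length at most 4
    (first_block_values), and that each is the image of the decreasing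
    arrangement under one basic subword (first_block). Subwords of different
    blocks have letters at distance at least 2, and therefore commute
    (separated_commuting_words). This gives a product tau of commuting basic
    subwords with tau lambda = sigma lambda, and tau = sigma since lambda is
    regular (weyl_inj). *)

Set Implicit Arguments.
Unset Strict Implicit.
Unset Printing Implicit Defensive.
Import Order.TTheory GRing.Theory Num.Theory.
Local Open Scope ring_scope.

(** * Reflections and their commutation *)

Section Reflections.
Variable r : nat.
Implicit Types a b u v : 'cV[rat]_r.

Lemma dotC u v : dot u v = dot v u.
Proof. by apply: eq_bigr => i _; rewrite mulrC. Qed.

Lemma dotDr u v1 v2 : dot u (v1 + v2) = dot u v1 + dot u v2.
Proof. by rewrite -big_split; apply: eq_bigr => i _; rewrite mxE mulrDr. Qed.

Lemma dotZr c u v : dot u (c *: v) = c * dot u v.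
Proof. by rewrite mulr_sumr; apply: eq_bigr => i _; rewrite mxE mulrCA. Qed.

Lemma dotBr u v1 v2 : dot u (v1 - v2) = dot u v1 - dot u v2.
Proof. by rewrite dotDr -scaleN1r dotZr mulN1r. Qed.

Lemma dot_eq0 a : (dot a a == 0) = (a == 0).
Proof.
apply/idP/eqP => [|->]; last by rewrite /dot big1 // => i _; rewrite mxE mul0r.
rewrite psumr_eq0 => [/allP a0|i _]; last by rewrite -expr2 sqr_ge0.
apply/matrixP => i j; rewrite ord1 mxE; apply/eqP.
by have := a0 i (mem_index_enum i); rewrite mulf_eq0 orbb.
Qed.

Lemma reflection_self a : a != 0 -> reflection a *m a = - a.
Proof.
move=> a0; rewrite reflectionE mulfK ?dot_eq0 // scaler_nat mulr2n.
by rewrite opprD addrA subrr sub0r.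
Qed.

Lemma reflection_orth a b : dot a b = 0 -> reflection b *m a = a.
Proof. by move=> ab0; rewrite reflectionE ab0 mulr0 mul0r scale0r subr0. Qed.

Lemma reflection_scale c a : c != 0 -> reflection (c *: a) = reflection a.
Proof.
move=> c0; rewrite /reflection dotZr dotC dotZr.
have -> : (c *: a) *m (c *: a)^T = (c * c) *: (a *m a^T).
  by apply/matrixP => i j; rewrite !mxE !big_ord1 !mxE; ring.
rewrite scalerA; congr (_ - _ *: _).
have [->|a0] := eqVneq (dot a a) 0; first by rewrite !mulr0 !invr0 !mulr0 !mul0r.
by field; rewrite c0 a0.
Qed.

Lemma reflectionK a : a != 0 -> reflection a *m reflection a = 1%:M.
Proof.
move=> a0; apply/matrixP=> i j.
have H v : reflection a *m (reflection a *m v) = v.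
  rewrite (reflectionE a v) mulmxBr reflectionE -scalemxAr reflection_self //.
  by rewrite scalerN opprK subrK.
have := H (delta_mx j 0); rewrite mulmxA -colE => /matrixP/(_ i 0) E.
by rewrite mxE in E; rewrite E !mxE andbT.
Qed.

(** If b is not orthogonal to a, then commuting forces the reflection in a to
    negate the image a - c b of a (with c <> 0), which makes b a multiple of
    a; but then the two reflections agree. *)
Lemma commuting_reflection_fix a b :
  reflection a != reflection b -> comm_mx (reflection a) (reflection b) ->
  reflection b *m a = a.
Proof.
move=> ab cab; have [->|a0] := eqVneq a 0; first by rewrite mulmx0.
apply: reflection_orth; apply: contraNeq ab => dab.
have b0 : b != 0.
  by apply: contraNneq dab => ->; rewrite -(scale0r 0) dotZr mul0r.
have daa : dot a a != 0 by rewrite dot_eq0.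
have dbb : dot b b != 0 by rewrite dot_eq0.
have : reflection a *m (reflection b *m a) = - (reflection b *m a).
  by rewrite mulmxA cab -mulmxA reflection_self // mulmxN.
rewrite [reflection b *m a]reflectionE mulmxBr -scalemxAr reflection_self //.
rewrite opprB [RHS]addrC => /addrI.
rewrite reflectionE (dotC b a).
set c := 2 * _ / _; set d := 2 * _ / dot a a => E.
have c0 : c != 0 by rewrite /c mulf_neq0 ?invr_eq0 // mulf_neq0.
have d0 : d != 0 by rewrite /d mulf_neq0 ?invr_eq0 // mulf_neq0.
have -> : b = (d / 2) *: a.
  move: E; rewrite -scalerN => /(scalerI c0) E.
  apply: (@scalerI _ _ 2%:R); first by [].
  rewrite scalerA mulrCA divff // mulr1 scaler_nat mulr2n.
  by rewrite -[X in X + _]E opprB subrK.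
by rewrite reflection_scale // mulf_neq0.
Qed.

Lemma orthogonal_reflections a b : a != 0 -> dot a b = 0 ->
  reflection a != reflection b /\ comm_mx (reflection a) (reflection b).
Proof.
move=> a0 ab0; split.
  apply: contra (a0) => /eqP /(congr1 (mulmx^~ a)) /=.
  rewrite reflection_self // reflection_orth // => /eqP.
  by rewrite eq_sym -subr_eq0 opprK -mulr2n -scaler_nat scaler_eq0.
have aTb : a^T *m b = 0.
  apply/matrixP => i j; rewrite !ord1 !mxE -[RHS]ab0.
  by apply: eq_bigr => k _; rewrite mxE.
have bTa : b^T *m a = 0 by rewrite -[LHS]trmxK trmx_mul trmxK aTb trmx0.
rewrite /comm_mx /reflection !mulmxBl !mulmxBr !mul1mx !mulmx1.
rewrite -!scalemxAl -!scalemxAr.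
rewrite -(mulmxA a) (mulmxA a^T) aTb -(mulmxA b) (mulmxA b^T) bTa.
by rewrite !mul0mx !mulmx0 !scaler0 !subr0 addrAC.
Qed.

End Reflections.

(** * The Weyl group acting on coordinates *)

Section Coordinates.
Variable r : nat.
Implicit Types (X Y : nat -> int) (i j : nat) (w : seq nat).

(** Coordinates are indexed from 1, like the roots; only the values of X at
    1, ..., r matter. *)
Definition vec X : 'cV[rat]_r := \col_(j < r) (X j.+1)%:~R.

Lemma eq_vec X Y : (forall j, (0 < j <= r)%N -> X j = Y j) -> vec X = vec Y.
Proof. by move=> XY; apply/matrixP => i j; rewrite !mxE XY //= ltn_ord. Qed.

Lemma vec_inj X Y : vec X = vec Y -> forall j, (0 < j <= r)%N -> X j = Y j.
Proof.
move=> /matrixP XY [|j] // jr; have := XY (Ordinal jr) 0.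
by rewrite !mxE /= => /intr_inj.
Qed.

Lemma vecD X Y : vec (fun j => X j + Y j) = vec X + vec Y.
Proof. by apply/matrixP => i j; rewrite !mxE rmorphD. Qed.

Lemma vecB X Y : vec (fun j => X j - Y j) = vec X - vec Y.
Proof. by apply/matrixP => i j; rewrite !mxE rmorphB. Qed.

Lemma eps_vec i : eps r i = vec (fun j => Posz (j == i)).
Proof. by apply/matrixP => k j; rewrite !mxE; case: (_ == _). Qed.

Lemma dot_eps X i : (0 < i <= r)%N -> dot (vec X) (eps r i) = (X i)%:~R.
Proof.
case: i => // i ir; rewrite /dot (bigD1 (Ordinal ir)) //= !mxE eqxx mulr1.
rewrite big1 ?addr0 // => j; rewrite !mxE eqSS -val_eqE /= => /negPf ->.
by rewrite mulr0.
Qed.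

Definition simple_coord i j : int :=
  if (i < r)%N then Posz (j == i) - Posz (j == i.+1) else 2 * Posz (j == r).

Lemma simple_root_vec i : simple_root r i = vec (simple_coord i).
Proof.
rewrite /simple_root /simple_coord; case: ifP => _; first by rewrite !eps_vec vecB.
rewrite eps_vec; apply/matrixP => k j; rewrite !mxE rmorphM /=.
by [].
Qed.

Lemma dot_simple_root X i : (0 < i <= r)%N ->
  dot (vec X) (simple_root r i) = (if (i < r)%N then X i - X i.+1 else 2 * X r)%:~R.
Proof.
move=> ir; rewrite /simple_root; case: ifP => ltir.
  by rewrite dotBr !dot_eps ?rmorphB //; lia.
by rewrite dotZr dot_eps ?rmorphM //; lia.
Qed.

Lemma dot_simple_roots i j : (0 < i <= r)%N -> (0 < j <= r)%N ->
  (i.+1 < j)%N -> dot (simple_root r i) (simple_root r j) = 0.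
Proof.
move=> ir jr ij; rewrite [simple_root r i]simple_root_vec dot_simple_root //.
rewrite -[RHS](@mulr0z rat 1); congr (_ *~ _).
by rewrite /simple_coord; do !case: ifP; lia.
Qed.

Lemma dot_simple_root_self i : (0 < i <= r)%N ->
  dot (simple_root r i) (simple_root r i) = if (i < r)%N then 2 else 4.
Proof.
move=> ir; rewrite [X in dot X]simple_root_vec dot_simple_root // /simple_coord.
case: ltnP => ri; last by rewrite eqxx.
by have -> : Posz (i == i) - Posz (i == i.+1) -
  (Posz (i.+1 == i) - Posz (i.+1 == i.+1)) = 2 by lia.
Qed.

Lemma simple_root_neq0 i : (0 < i <= r)%N -> simple_root r i != 0.
Proof.
by move=> ir; rewrite -dot_eq0 dot_simple_root_self //; case: ifP.
Qed.

(** The simple reflections act on coordinates by exchanging neighbours, the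
    last one by changing the sign of the last coordinate. *)
Definition simple_act i X j : int :=
  if (i < r)%N then (if j == i then X i.+1 else if j == i.+1 then X i else X j)
  else if j == r then - X r else X j.

Lemma simple_reflection_vec i X : (0 < i <= r)%N ->
  simple_reflection r i *m vec X = vec (simple_act i X).
Proof.
move=> ir; rewrite /simple_reflection reflectionE.
have -> : 2 * dot (vec X) (simple_root r i) / dot (simple_root r i) (simple_root r i)
   = (if (i < r)%N then X i - X i.+1 else X i)%:~R.
  rewrite dot_simple_root_self // dot_simple_root //.
  by case: ltnP => ri; [|have <- : i = r by lia]; rewrite ?rmorphM; field.
rewrite simple_root_vec; apply/matrixP => k j; rewrite !mxE -rmorphM -rmorphB /=.
congr _%:~R; rewrite /simple_act /simple_coord.
case: ifP => ltir.
  case: eqP => [->|ki]; first by case: eqP; lia.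
  by case: eqP => [->|ki']; lia.
have -> : i = r by lia.
by case: eqP => [->|ki]; lia.
Qed.

Definition word_act w X : nat -> int := foldr simple_act X w.

Definition valid_word w := all (fun i => (0 < i <= r)%N) w.

Lemma word_elt_cons i w : word_elt r (i :: w) = simple_reflection r i *m word_elt r w.
Proof. by rewrite /word_elt big_cons. Qed.

Lemma word_elt_cat u w : word_elt r (u ++ w) = word_elt r u *m word_elt r w.
Proof.
elim: u => [|i u IH]; first by rewrite /word_elt big_nil mul1mx.
by rewrite cat_cons !word_elt_cons IH mulmxA.
Qed.

Lemma word_elt_vec w X : valid_word w -> word_elt r w *m vec X = vec (word_act w X).
Proof.
elim: w => [|i w IH] /=; first by rewrite /word_elt big_nil mul1mx.
by case/andP=> ir rw; rewrite word_elt_cons -mulmxA IH // simple_reflection_vec.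
Qed.

Lemma word_elt_revK w : valid_word w -> word_elt r (rev w) *m word_elt r w = 1%:M.
Proof.
elim: w => [|i w IH] /=; first by rewrite /word_elt !big_nil mul1mx.
case/andP=> ir rw; rewrite rev_cons -cats1 word_elt_cat -mulmxA.
have -> : word_elt r [:: i] = simple_reflection r i.
  by rewrite word_elt_cons /word_elt big_nil mulmx1.
rewrite word_elt_cons (mulmxA (simple_reflection r i)) reflectionK ?mul1mx ?IH //.
exact: simple_root_neq0.
Qed.

(** The simple reflections being involutions, the inverse of a word is the
    reversed word; hence every element of the group is a word. *)
Lemma weyl_word s : weyl s -> exists2 w, valid_word w & s = word_elt r w.
Proof.
elim=> {s} [i ir||_ _ _ [u ru ->] _ [w rw ->]|_ _ [w rw ->]].
- exists [:: i]; rewrite /valid_word /= ?ir //.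
  by rewrite word_elt_cons /word_elt big_nil mulmx1.
- by exists [::]; rewrite // /word_elt big_nil.
- by exists (u ++ w); rewrite ?word_elt_cat // /valid_word all_cat; apply/andP.
- exists (rev w); first by rewrite /valid_word all_rev.
  have K := word_elt_revK rw; have [_ U] := mulmx1_unit K.
  by rewrite -[RHS](mulmxK U) K mul1mx.
Qed.

Lemma word_act_signed w : valid_word w -> exists (p : nat -> nat) (e : nat -> int),
  [/\ forall j, (0 < j <= r)%N -> (0 < p j <= r)%N,
      {in [pred j | 0 < j <= r]%N &, injective p},
      forall j, e j = 1 \/ e j = -1 &
      forall X j, (0 < j <= r)%N -> word_act w X j = e j * X (p j)].
Proof.
elim: w => [|i w IH] /=.
  by exists id, (fun=> 1); split=> // [|X j _]; [left|rewrite mul1r].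
case/andP=> ir /IH [p [e [pr pinj e1 ew]]].
pose q j := if (i < r)%N
  then (if j == i then i.+1 else if j == i.+1 then i else j) else j.
exists (p \o q), (fun j => (if (i < r)%N || (j != r) then 1 else -1) * e (q j)).
split=> [j jr|j k jr kr /=|j|X j jr] /=.
- by apply: pr; rewrite /q; do !case: ifP => //; lia.
- move/pinj => H; have {H} : q j = q k.
    by apply: H; move: jr kr; rewrite !inE /q; do !case: ifP => //; lia.
  by rewrite /q; do !case: eqP => //; do ?case: ifP => //; lia.
- by case: ifP; case: (e1 (q j)) => ->; lia.
- rewrite /simple_act /q; case: ifP => ltir /=.
    by do !case: ifP => //; rewrite ?ew ?mul1r //; lia.
  by case: eqP => [->|_]; rewrite ?ew ?mul1r ?mulN1r ?mulNr //; lia.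
Qed.

End Coordinates.

(** * The highest root, rho, and Kostant's partition function *)

Section HighestWeight.
Variable r : nat.

Lemma vec_sum_eps X : vec r X = \sum_(1 <= i < r.+1) (X i)%:~R *: eps r i.
Proof.
apply/matrixP => k j; rewrite ord1 summxE mxE (bigD1_seq k.+1) ?iota_uniq //=; last first.
  by rewrite mem_index_iota; have := ltn_ord k; lia.
rewrite !mxE eqxx mulr1 big1 ?addr0 // => i.
by rewrite !mxE eq_sym => /negPf ->; rewrite mulr0.
Qed.

Definition rho_coord j : int := Posz r.+1 - Posz j.

Lemma rho_vec : rho r = vec r rho_coord.
Proof.
rewrite /rho /pos_roots !big_cat /= !big_allpairs_dep big_map addrA -!big_split /=.
rewrite vec_sum_eps scaler_sumr; apply: eq_big_nat => i ir.
rewrite -big_split /= (eq_bigr (fun=> 2 *: eps r i)) => [|j _]; last first.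
  by rewrite scaler_nat addrCA addrC subrK mulr2n.
rewrite big_const_nat iter_addr_0 -mulrSr -scaler_nat !scalerA; congr (_ *: _).
have -> : rho_coord i = Posz (r.+1 - i.+1).+1 by rewrite /rho_coord; lia.
by rewrite mulrC mulfK.
Qed.

Lemma highest_root_vec : (0 < r)%N ->
  highest_root r = vec r (fun j => 2 * Posz (j == 1%N)).
Proof.
move=> r0; rewrite /highest_root.
rewrite (@telescope_sumr_eq _ _ _ (fun i => - (2 *: eps r i))); last first.
- move=> k kr; rewrite /simple_root; case: ifP; last by lia.
  by rewrite scalerBr opprK addrC.
- by [].
rewrite /simple_root ltnn opprK addrAC addNr add0r eps_vec.
by apply/matrixP => k j; rewrite !mxE rmorphM.
Qed.

(** These coordinates are (r + 2, r - 1, r - 2, ..., 1). *)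
Definition highest_rho_coord j : int := rho_coord j + 2 * Posz (j == 1%N).

Lemma highest_rho_coord1 : highest_rho_coord 1%N = Posz r.+2.
Proof. by rewrite /highest_rho_coord /rho_coord eqxx mulr1 -natz; lia. Qed.

Lemma highest_rho_coord_gt1 j : (1 < j)%N -> highest_rho_coord j = rho_coord j.
Proof. by rewrite /highest_rho_coord; case: eqP => [->|_ _] //; rewrite mulr0 addr0. Qed.

Lemma highest_rho_vec : (0 < r)%N -> highest_root r + rho r = vec r highest_rho_coord.
Proof. by move=> r0; rewrite addrC rho_vec highest_root_vec // -vecD. Qed.

(** The partition function is positive exactly on the monoid generated by the
    positive roots. Closure under sums shows that it is positive on sums of
    simple roots; conversely the partial sums of coordinates, which are
    nonnegative on positive roots, are nonnegative where it is positive. *)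
Lemma kostant_gt0P (xi : 'cV[rat]_r) :
  (0 < kostant xi)%N <->
  exists m : {ffun seq_sub (pos_roots r) -> nat}, \sum_a val a *+ m a = xi.
Proof.
rewrite /kostant cardfs_gt0; split.
  case/fset0Pn => m; rewrite in_fset_set; last exact: kostant_ways_finite.
  by rewrite inE => ?; exists m.
case=> m mxi; apply/fset0Pn; exists m.
by rewrite in_fset_set ?inE //; apply: kostant_ways_finite.
Qed.

Lemma kostant_gt0_0 : (0 < kostant (0 : 'cV[rat]_r))%N.
Proof.
apply/kostant_gt0P; exists [ffun=> 0%N].
by rewrite big1 // => a _; rewrite ffunE.
Qed.

Lemma kostant_gt0_pos_root (a : 'cV[rat]_r) :
  a \in pos_roots r -> (0 < kostant a)%N.
Proof.
move=> ha; apply/kostant_gt0P; exists [ffun b => (b == SeqSub ha) : nat].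
rewrite (bigD1 (SeqSub ha)) //= ffunE eqxx big1 ?addr0 // => b.
by rewrite ffunE => /negPf ->.
Qed.

Lemma kostant_gt0D (xi eta : 'cV[rat]_r) :
  (0 < kostant xi)%N -> (0 < kostant eta)%N -> (0 < kostant (xi + eta))%N.
Proof.
move=> /kostant_gt0P [m <-] /kostant_gt0P [n <-]; apply/kostant_gt0P.
exists [ffun a => m a + n a]%N.
by rewrite -big_split; apply: eq_bigr => a _; rewrite ffunE mulrnDr.
Qed.

Lemma simple_root_pos i : (0 < i <= r)%N -> simple_root r i \in pos_roots r.
Proof.
move=> ir; rewrite /pos_roots !mem_cat /simple_root; case: ifP => ltir.
  apply/orP; left; apply/allpairsPdep; exists i, i.+1.
  by rewrite !mem_index_iota; split=> //; lia.
apply/orP; right; apply/orP; right; apply: (map_f (fun i => 2 *: eps r i)).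
by rewrite mem_index_iota; lia.
Qed.

Lemma kostant_gt0_simple_roots l : valid_word r l ->
  (0 < kostant (\sum_(i <- l) simple_root r i))%N.
Proof.
elim: l => [|i l IH] /=; first by rewrite big_nil kostant_gt0_0.
case/andP=> ir /IH; rewrite big_cons; apply: kostant_gt0D.
exact/kostant_gt0_pos_root/simple_root_pos.
Qed.

Definition partial_sum k (v : 'cV[rat]_r) : rat := \sum_(j < r | (j < k)%N) v j 0.

Lemma partial_sumD k u v : partial_sum k (u + v) = partial_sum k u + partial_sum k v.
Proof. by rewrite -big_split; apply: eq_bigr => j _; rewrite mxE. Qed.

Lemma partial_sumZ k c v : partial_sum k (c *: v) = c * partial_sum k v.
Proof. by rewrite mulr_sumr; apply: eq_bigr => j _; rewrite mxE. Qed.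

Lemma partial_sum_eps k i : (0 < i <= r)%N -> partial_sum k (eps r i) = (i <= k)%:R.
Proof.
case: i => // i ir; rewrite /partial_sum big_mkcond (bigD1 (Ordinal ir)) //= mxE eqxx.
rewrite big1 ?addr0; last first.
  by move=> j; rewrite mxE eqSS -val_eqE /= => /negPf ->; case: ifP.
by case: ltnP.
Qed.

Lemma partial_sum_pos_root k a : a \in pos_roots r -> 0 <= partial_sum k a.
Proof.
rewrite !mem_cat => /or3P[/allpairsPdep[i [j []]]|/allpairsPdep[i [j []]]|/mapP[i]];
  rewrite !mem_index_iota ?ltnS.
- move=> ir jr ->; rewrite -scaleN1r partial_sumD partial_sumZ.
  rewrite !partial_sum_eps; [|by lia..].
  by rewrite mulN1r subr_ge0 ler_nat; lia.
- by move=> ir jr ->; rewrite partial_sumD !partial_sum_eps -?natrD ?ler0n //; lia.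
- by move=> ir ->; rewrite partial_sumZ partial_sum_eps // -natrM ler0n.
Qed.

Lemma partial_sum_vec k X : (k <= r)%N ->
  partial_sum k (vec r X) = (\sum_(1 <= j < k.+1) X j)%:~R.
Proof.
move=> kr; rewrite /partial_sum rmorph_sum /= big_add1 /=.
rewrite big_mkord (big_ord_widen r (fun j => (X j.+1)%:~R)) //.
by apply: eq_bigr => j _; rewrite mxE.
Qed.

Lemma kostant_gt0_partial_sum k X : (k <= r)%N -> (0 < kostant (vec r X))%N ->
  0 <= \sum_(1 <= j < k.+1) X j.
Proof.
move=> kr /kostant_gt0P [m mX]; rewrite -(ler0z rat) -partial_sum_vec // -mX.
apply: (big_ind (fun v => 0 <= partial_sum k v)) => [|u v hu hv|a _].
- by rewrite -(scale0r 0) partial_sumZ mul0r.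
- by rewrite partial_sumD addr_ge0.
- by rewrite -scaler_nat partial_sumZ mulr_ge0 ?ler0n ?partial_sum_pos_root // ssvalP.
Qed.

End HighestWeight.

(** * Products of commuting basic subwords *)

Section Sufficiency.
Variable r : nat.

Lemma basic_allowable_valid w : basic_allowable r w -> valid_word r w.
Proof. by case=> [|i|i|i|i|i] *; rewrite /valid_word //=; lia. Qed.

Lemma sum_simple_roots_vec l :
  \sum_(i <- l) simple_root r i = vec r (fun j => \sum_(i <- l) simple_coord r i j).
Proof.
elim: l => [|i l IH].
  by rewrite big_nil; apply/matrixP => k j; rewrite !mxE big_nil.
rewrite big_cons IH simple_root_vec -vecD; apply: eq_vec => j _.
by rewrite big_cons.
Qed.

(** The sum of the roots alpha_i over the multiset l is what w takes away from
    highest_root + rho. The multiplicities at most 2 (at most 1 for alpha_r)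
    are those of the simple roots in the highest root, and the
    highest root can pay for what is taken away. *)
Lemma basic_allowable_lowering w : (0 < r)%N -> basic_allowable r w ->
  exists l, [/\ {subset l <= w}, forall i, (count_mem i l <= 2)%N,
    (count_mem r l <= 1)%N &
    word_elt r w *m (highest_root r + rho r) =
      highest_root r + rho r - \sum_(i <- l) simple_root r i].
Proof.
move=> r0 hw; rewrite highest_rho_vec //.
rewrite word_elt_vec ?basic_allowable_valid //.
suff [l [lw l2 lr H]] : exists l, [/\ {subset l <= w}, forall i, (count_mem i l <= 2)%N,
    (count_mem r l <= 1)%N & forall j, (0 < j <= r)%N ->
      word_act r w (highest_rho_coord r) j =
      highest_rho_coord r j - \sum_(i <- l) simple_coord r i j].
  by exists l; split=> //; rewrite sum_simple_roots_vec -vecB; apply: eq_vec.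
case: w / hw => [|i i2 ir|i i2 ir|i i2 ir|i i2 ir|i i2 ir].
- by exists [::]; split=> // j _; rewrite big_nil subr0.
- exists [:: i]; split=> [k|k||j jr] /=; rewrite ?inE.
  + by [].
  + by lia.
  + by lia.
  + rewrite big_cons big_nil /simple_act /simple_coord /highest_rho_coord /rho_coord.
    by repeat (case: ifP => ?; try lia).
- exists [:: i; i; i.+1]; split=> [k|k||j jr] /=; rewrite ?inE.
  + by lia.
  + by lia.
  + by lia.
  + rewrite !big_cons big_nil /simple_act /simple_coord /highest_rho_coord /rho_coord.
    by repeat (case: ifP => ?; try lia).
- exists [:: i; i.+1; i.+1]; split=> [k|k||j jr] /=; rewrite ?inE.
  + by lia.
  + by lia.
  + by lia.
  + rewrite !big_cons big_nil /simple_act /simple_coord /highest_rho_coord /rho_coord.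
    by repeat (case: ifP => ?; try lia).
- exists [:: i; i; i.+1; i.+1]; split=> [k|k||j jr] /=; rewrite ?inE.
  + by lia.
  + by lia.
  + by lia.
  + rewrite !big_cons big_nil /simple_act /simple_coord /highest_rho_coord /rho_coord.
    by repeat (case: ifP => ?; try lia).
- exists [:: i; i; i.+1; i.+2; i.+2]; split=> [k|k||j jr] /=; rewrite ?inE.
  + by lia.
  + by lia.
  + by lia.
  + rewrite !big_cons big_nil /simple_act /simple_coord /highest_rho_coord /rho_coord.
    by repeat (case: ifP => ?; try lia).
Qed.

Lemma commuting_words_fix u l :
  (forall i j, i \in u -> j \in l ->
    simple_reflection r i != simple_reflection r j /\
    comm_mx (simple_reflection r i) (simple_reflection r j)) ->
  word_elt r u *m (\sum_(i <- l) simple_root r i) = \sum_(i <- l) simple_root r i.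
Proof.
elim: u => [|i u IH] H; first by rewrite /word_elt big_nil mul1mx.
rewrite word_elt_cons -mulmxA IH => [|j k ju kl]; last first.
  by apply: H; rewrite // inE ju orbT.
rewrite mulmx_sumr; apply: eq_big_seq => j jl.
have [||sij cij] := H i j; rewrite ?inE ?eqxx //.
by apply: commuting_reflection_fix; rewrite 1?eq_sym.
Qed.

(** Each factor fixes the simple roots that the other factors take away, so
    that the effects of the factors add up; the multiplicities do not grow,
    because the factors share no letter. *)
Lemma commuting_product_lowering k (w : 'I_k -> seq nat) : (0 < r)%N ->
  (forall a, basic_allowable r (w a)) ->
  (forall a b, a != b -> commuting_words r (w a) (w b)) ->
  exists l, [/\ forall i, i \in l -> exists a, i \in w a,
    forall i, (count_mem i l <= 2)%N, (count_mem r l <= 1)%N &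
    (\big[mulmx/1%:M]_(a < k) word_elt r (w a)) *m (highest_root r + rho r) =
      highest_root r + rho r - \sum_(i <- l) simple_root r i].
Proof.
move=> r0; elim: k w => [|k IH] w bw cw.
  by exists [::]; split=> //; rewrite !big_ord0 big_nil mul1mx subr0.
have [//|a b ab|l [lw l2 lr El]] := IH (fun a => w (lift ord0 a)).
  by apply: cw; rewrite (inj_eq lift_inj).
have [l0 [l0w l02 l0r El0]] := basic_allowable_lowering r0 (bw ord0).
have c0 i j : i \in w ord0 -> j \in l ->
    simple_reflection r i != simple_reflection r j /\
    comm_mx (simple_reflection r i) (simple_reflection r j).
  by move=> iw /lw [a ja]; apply: (cw ord0 (lift ord0 a)).
have disj i : i \in l0 -> i \notin l.
  by move=> /l0w iw; apply/negP => /(c0 _ _ iw) []; rewrite eqxx.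
have cnt i n : (count_mem i l0 <= n)%N -> (count_mem i l <= n)%N ->
    (count_mem i (l0 ++ l) <= n)%N.
  rewrite count_cat => h0 h; have [/disj/count_memPn ->|] := boolP (i \in l0).
    by rewrite addn0.
  by move/count_memPn ->.
exists (l0 ++ l); split=> [i|i||].
- by rewrite mem_cat => /orP [/l0w|/lw [a]]; [exists ord0|exists (lift ord0 a)].
- exact: cnt.
- exact: cnt.
- rewrite big_ord_recl -mulmxA El mulmxBr El0 commuting_words_fix // big_cat /=.
  by rewrite opprD addrA.
Qed.

(** What remains of the highest root, written as a multiset of simple roots,
    is again a sum of simple roots. *)
Lemma highest_root_minus_gt0 l : (0 < r)%N -> valid_word r l ->
  (forall i, (count_mem i l <= 2)%N) -> (count_mem r l <= 1)%N ->
  (0 < kostant (highest_root r - \sum_(i <- l) simple_root r i))%N.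
Proof.
move=> r0 rl l2 lr.
(* alpha_r occurs once in h, the other simple roots twice *)
pose h := index_iota 1 r ++ index_iota 1 r.+1.
have Eh : highest_root r = \sum_(i <- h) simple_root r i.
  rewrite big_cat /= big_nat_recr; last by lia.
  rewrite /= addrA -big_split; congr (_ + _); apply: eq_bigr => i _.
  by rewrite scaler_nat mulr2n.
have /count_subseqP [l' /perm_to_subseq [l'' hl'] ll'] :
    forall i, (count_mem i l <= count_mem i h)%N.
  move=> i; have [/(allP rl) ir|/count_memPn ->] // := boolP (i \in l).
  rewrite count_cat !(count_uniq_mem _ (iota_uniq _ _)) !mem_index_iota.
  have := l2 i; have [->|ne] := eqVneq i r; lia.
rewrite Eh (perm_big _ hl') big_cat (perm_big _ ll') addrAC subrr add0r.
apply: kostant_gt0_simple_roots; apply/allP => i il''.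
have : i \in h by rewrite (perm_mem hl') mem_cat il'' orbT.
by rewrite mem_cat !mem_index_iota; lia.
Qed.

Lemma commuting_product_kostant_gt0 sigma : (0 < r)%N -> commuting_bas_product sigma ->
  (0 < kostant (sigma *m (highest_root r + rho r) - rho r))%N.
Proof.
move=> r0 [k [w [_ bw cw ->]]].
have [l [lw l2 lr ->]] := commuting_product_lowering r0 bw cw.
rewrite addrAC addrK; apply: highest_root_minus_gt0 => //.
apply/allP => i /lw [a]; exact: (allP (basic_allowable_valid (bw a))).
Qed.

End Sufficiency.

(** * Splitting off the first block *)

Section Necessity.
Variable r : nat.
Implicit Types (X : nat -> int) (p q : nat).

(** The situation after the entries before position p are settled: the others
    are, up to signs, the numbers 1, ..., r + 1 - p in some order, and their
    partial sums fall short by at most 2 of those of rho. The bound 2 is the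
    amount by which highest_root + rho exceeds rho in its first coordinate. *)
Definition small_deficit p X : Prop :=
  [/\ forall j, (p <= j <= r)%N -> (0 < `|X j| <= r.+1 - p)%N,
      forall j k, (p <= j)%N -> (j < k)%N -> (k <= r)%N -> `|X j|%N <> `|X k|%N &
      forall k, (p <= k <= r)%N -> \sum_(p <= j < k.+1) (rho_coord r j - X j) <= 2].

(** The vector left when a block ending before position q is straightened. *)
Definition reset_below q X j : int := if (j < q)%N then highest_rho_coord r j else X j.

Lemma small_deficit_tail p q X : (p <= q)%N -> small_deficit p X ->
  \sum_(p <= j < q) (rho_coord r j - X j) = 0 ->
  (forall j, (q <= j <= r)%N -> (`|X j| <= r.+1 - q)%N) ->
  small_deficit q (reset_below q X).
Proof.
move=> pq [bX dX sX] s0 bq; rewrite /reset_below; split.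
- move=> j jr; rewrite ifF; last by lia.
  by have := bX j; have := bq j; lia.
- move=> j k qj jk kr; rewrite !ifF; [|by lia..].
  by apply: dX; lia.
- move=> k kr; have := sX k; rewrite (big_cat_nat (n := q)) /=; [|lia|lia].
  rewrite s0 add0r => H.
  rewrite (eq_big_nat _ _ (F2 := fun j => rho_coord r j - X j)).
    by apply: H; lia.
  by move=> j jq; rewrite ifF; lia.
Qed.

Lemma word_act_outside p q w X j :
  (forall i, i \in w -> (p <= i)%N && (i.+2 <= q)%N) -> (q <= r.+1)%N ->
  (j < p)%N || (q <= j)%N -> word_act r w X j = X j.
Proof.
move=> wpq qr jpq; elim: w wpq => [|i w IH] //= wpq.
have := wpq i (mem_head _ _); rewrite /simple_act => ipq.
rewrite ifT ?ifF; [|by lia..].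
by apply: IH => k kw; apply: wpq; rewrite inE kw orbT.
Qed.

Lemma word_act_inside p q w X Y j :
  (forall i, i \in w -> (p <= i)%N && (i.+2 <= q)%N) -> (q <= r.+1)%N ->
  (forall k, (p <= k < q)%N -> X k = Y k) ->
  (p <= j < q)%N -> word_act r w X j = word_act r w Y j.
Proof.
move=> wpq qr XY; elim: w wpq j => [|i w IH] wpq j jpq /=; first exact: XY.
have ipq := wpq i (mem_head _ _).
have {}IH k : (p <= k < q)%N -> word_act r w X k = word_act r w Y k.
  by apply: IH => l lw; apply: wpq; rewrite inE lw orbT.
by rewrite /simple_act; case: ifP => [_|]; last lia; rewrite !IH; [|by lia..].
Qed.

(** The first partial sums decide everything: with N = r + 1 - p, the entries
    from position p on start with N, or N-1 N, or N-1 N-2 N, or N-2 N N-1, or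
    N-2 N-1 N, or N-2 N N-3 N-1; or p = r and the last entry is -1. At each
    step a smaller entry would make the deficit exceed 2, and each list stops
    as soon as the deficit is back to 0. *)
Lemma first_block_values p X : (p <= r)%N -> small_deficit p X ->
  [\/ X p = rho_coord r p,
      p = r /\ X p = -1,
      (p < r)%N /\ [/\ X p = rho_coord r p.+1 & X p.+1 = rho_coord r p] |
      (p.+1 < r)%N /\
      [\/ [/\ X p = rho_coord r p.+1, X p.+1 = rho_coord r p.+2 &
              X p.+2 = rho_coord r p],
          [/\ X p = rho_coord r p.+2, X p.+1 = rho_coord r p &
              X p.+2 = rho_coord r p.+1],
          [/\ X p = rho_coord r p.+2, X p.+1 = rho_coord r p.+1 &
              X p.+2 = rho_coord r p] |
          (p.+2 < r)%N /\ [/\ X p = rho_coord r p.+2, X p.+1 = rho_coord r p,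
            X p.+2 = rho_coord r p.+3 & X p.+3 = rho_coord r p.+1]]].
Proof.
move=> pr [bX dX sX].
have b j : (p <= j)%N -> (j <= r)%N -> X j <> 0 /\ X j <= rho_coord r p.
  move=> pj jr; have /andP[] := bX j (introT andP (conj pj jr)); rewrite /rho_coord.
  by clear -pj jr pr; lia.
have d j k : (p <= j)%N -> (j < k)%N -> (k <= r)%N -> X j <> X k.
  by move=> pj jk kr E; apply: (dX j k pj jk kr); rewrite E.
have s k : (p <= k)%N -> (k <= r)%N -> \sum_(p <= j < k.+1) (rho_coord r j - X j) <= 2.
  by move=> pk kr; apply: sX; rewrite pk.
clear bX dX sX.
have [b0 b0'] := b p (leqnn p) pr.
have := s p (leqnn p) pr; rewrite big_nat1 => s0.
have [H|[H|[[p1 H]|[p2 H]]]] : X p = rho_coord r p \/ (p = r /\ X p = -1) \/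
    ((p < r)%N /\ X p = rho_coord r p.+1) \/ ((p.+1 < r)%N /\ X p = rho_coord r p.+2).
- by move: b0 b0' s0; rewrite /rho_coord; clear -pr; lia.
- by constructor 1.
- by constructor 2.
- have [_ b1] := b p.+1 (leqnSn p) p1.
  have := s p.+1 (leqnSn p) p1; rewrite !big_nat_recr ?big_geq //= add0r H => s1.
  have := d p p.+1 (leqnn p) (leqnn _) p1; rewrite H => d01.
  have [H1|[p2 H1]] : X p.+1 = rho_coord r p \/
      ((p.+1 < r)%N /\ X p.+1 = rho_coord r p.+2).
  + have := b p.+1 (leqnSn p) p1.
    by move: b1 s1 d01; rewrite /rho_coord; clear -p1; lia.
  + by constructor 3.
  + have p02 : (p <= p.+2)%N by clear; lia.
    have [_ b2] := b p.+2 p02 p2.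
    have := s p.+2 p02 p2;
    rewrite !big_nat_recr ?big_geq //= ?add0r ?H ?H1; [|by clear; lia..].
    move=> s2.
    have := d p p.+2 (leqnn p) (leqnSn _) p2; rewrite H => d02.
    have := d p.+1 p.+2 (leqnSn p) (leqnn _) p2; rewrite H1 => d12.
    have H2 : X p.+2 = rho_coord r p.
      by move: b2 s2 d02 d12; rewrite /rho_coord; clear -p1; lia.
    by constructor 4; split=> //; constructor 1.
- have p1 : (p < r)%N by clear -p2; lia.
  have p02 : (p <= p.+2)%N by clear; lia.
  have [_ b1] := b p.+1 (leqnSn p) p1.
  have := s p.+1 (leqnSn p) p1; rewrite !big_nat_recr ?big_geq //= add0r H => s1.
  have [b2n b2] := b p.+2 p02 p2.
  have := s p.+2 p02 p2;
  rewrite !big_nat_recr ?big_geq //= ?add0r ?H; [|by clear; lia..].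
  move=> s2.
  have := d p p.+1 (leqnn p) (leqnn _) p1; rewrite H => d01.
  have := d p p.+2 (leqnn p) (leqnSn _) p2; rewrite H => d02.
  have := d p.+1 p.+2 (leqnSn p) (leqnn _) p2 => d12.
  have [H1|H1] : X p.+1 = rho_coord r p \/ X p.+1 = rho_coord r p.+1.
  + by move: b1 s1 d01; rewrite /rho_coord; clear; lia.
  + rewrite H1 in s2 d12.
    have [H2|[p3 H2]] : X p.+2 = rho_coord r p.+1 \/
        ((p.+2 < r)%N /\ X p.+2 = rho_coord r p.+3).
    * by move: b2n b2 s2 d02 d12; rewrite /rho_coord; clear -p2; lia.
    * by constructor 4; split=> //; constructor 2.
    * have p03 : (p <= p.+3)%N by clear; lia.
      have [_ b3] := b p.+3 p03 p3.
      have := s p.+3 p03 p3;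
      rewrite !big_nat_recr ?big_geq //= ?add0r ?H ?H1 ?H2; [|by clear; lia..].
      move=> s3.
      have := d p p.+3 (leqnn p) p02 p3; rewrite H => d03.
      have := d p.+1 p.+3 (leqnSn p) (leqnSn _) p3; rewrite H1 => d13.
      have := d p.+2 p.+3 p02 (leqnn _) p3; rewrite H2 => d23.
      have H3 : X p.+3 = rho_coord r p.+1.
        by move: b3 s3 d03 d13 d23; rewrite /rho_coord; clear; lia.
      by constructor 4; split=> //; constructor 4.
  + rewrite H1 in s2 d12.
    have H2 : X p.+2 = rho_coord r p.
      by move: b2 s2 d02 d12; rewrite /rho_coord; clear; lia.
    by constructor 4; split=> //; constructor 3.
Qed.

Definition splits_off_block p X : Prop :=
  exists w q, [/\ basic_allowable r w, (p < q)%N,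
    forall i, i \in w -> (p <= i)%N && (i.+2 <= q)%N,
    small_deficit q (reset_below q X) &
    forall j, (0 < j <= r)%N -> word_act r w (reset_below q X) j = X j].

(** A word that acts inside [p, q) and reproduces there the entries of X
    splits off as soon as these entries are rho_p, ..., rho_(q-1) in some
    order: these values being used up, the later entries are at most
    r + 1 - q in absolute value, and the deficits start again from 0 at q. *)
Lemma split_block p q w X : (1 < p)%N -> (p < q)%N -> (q <= r.+1)%N ->
  small_deficit p X -> (forall j, (0 < j < p)%N -> X j = highest_rho_coord r j) ->
  basic_allowable r w ->
  (forall i, i \in w -> (p <= i)%N && (i.+2 <= q)%N) ->
  (forall j, (p <= j < q)%N -> word_act r w (highest_rho_coord r) j = X j) ->
  (forall c, (p <= c < q)%N -> exists2 j, (p <= j < q)%N & X j = rho_coord r c) ->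
  \sum_(p <= j < q) (rho_coord r j - X j) = 0 ->
  splits_off_block p X.
Proof.
move=> p2 pq qr hX hd bw wpq wX onto s0; have [bX dX _] := hX.
exists w, q; split=> //.
  apply: (small_deficit_tail _ hX) => // [|j /andP[qj jr]]; first by lia.
  rewrite leqNgt; apply/negP => Xj.
  have [|k kpq Ek] := onto (r.+1 - `|X j|)%N; first by have := bX j; lia.
  by have := dX k j; have := bX j; rewrite Ek /rho_coord; lia.
move=> j jr; have [jp|pj] := ltnP j p.
  rewrite (word_act_outside _ wpq) // ?jp // /reset_below ifT; last by lia.
  by rewrite hd //; lia.
have [jq|qj] := ltnP j q.
  rewrite -wX; last by lia.
  apply: (word_act_inside wpq) => // [k kpq|]; last by lia.
  by rewrite /reset_below ifT; lia.
by rewrite (word_act_outside _ wpq) // ?qj ?orbT // /reset_below ifF; lia.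
Qed.

(** The possible beginnings are exactly the arrangements produced by the basic
    subwords. *)
Lemma first_block p X : (1 < p)%N -> (p <= r)%N -> small_deficit p X ->
  (forall j, (0 < j < p)%N -> X j = highest_rho_coord r j) ->
  splits_off_block p X.
Proof.
move=> p2 pr hX hd.
have block q w : basic_allowable r w -> (p < q)%N -> (q <= r.+1)%N -> _ :=
  fun bw pq qr => split_block p2 pq qr hX hd bw.
have in1 j : (p <= j < p.+1)%N -> j = p by lia.
have in2 j : (p <= j < p.+2)%N -> j = p \/ j = p.+1 by lia.
have in3 j : (p <= j < p.+3)%N -> [\/ j = p, j = p.+1 | j = p.+2].
  move=> jp; have [?|[?|?]] : j = p \/ j = p.+1 \/ j = p.+2;
  by [lia|constructor 1|constructor 2|constructor 3].
have in4 j : (p <= j < p.+4)%N -> [\/ j = p, j = p.+1, j = p.+2 | j = p.+3].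
  move=> jp; have [?|[?|[?|?]]] : j = p \/ j = p.+1 \/ j = p.+2 \/ j = p.+3;
  by [lia|constructor 1|constructor 2|constructor 3|constructor 4].
have Lp j : (p <= j)%N -> highest_rho_coord r j = rho_coord r j.
  by move=> pj; apply: highest_rho_coord_gt1; lia.
have [E0|[pE E0]|[p1 [E0 E1]]|[p1 [[E0 E1 E2]|[E0 E1 E2]|[E0 E1 E2]|[p3 [E0 E1 E2 E3]]]]] :=
  first_block_values pr hX.
- apply: (block p.+1 [::]) => //; first exact: bas_id.
  + by move=> j /in1 -> /=; rewrite Lp.
  + by move=> c /in1 ->; exists p; rewrite ?E0 //; lia.
  + by rewrite big_nat1 E0 subrr.
(* The end r.+2 of this block lies beyond the last position, because here
   the letter is the last position itself. *)
- exists [:: r], r.+2; split.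
  + by apply: bas_s; lia.
  + by lia.
  + by move=> i; rewrite inE; lia.
  + by split=> *; exfalso; lia.
  + move=> j jr /=; rewrite /simple_act ltnn /reset_below.
    have [->|jr'] := eqVneq j r.
      have E0' : X r = -1 by rewrite -pE.
      by rewrite E0' ifT ?Lp /rho_coord; lia.
    by rewrite ifT ?hd //; lia.
- apply: (block p.+2 [:: p]) => //; try lia.
  + by apply: bas_s; lia.
  + by move=> i; rewrite inE; lia.
  + by move=> j /in2 [] -> /=; rewrite /simple_act p1 ?eqxx ?E0 ?E1 ?ifF ?Lp //; lia.
  + by move=> c /in2 [] ->; [exists p.+1|exists p];
      rewrite ?E0 ?E1 //; lia.
  + by rewrite !big_nat_recr ?big_geq //= E0 E1; lia.
- apply: (block p.+3 [:: p.+1; p]) => //; try lia.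
  + by apply: bas_us; lia.
  + by move=> i; rewrite !inE; lia.
  + by move=> j /in3 [] -> /=; rewrite /simple_act; repeat (case: ifP => ?; try lia);
      rewrite ?E0 ?E1 ?E2 Lp //; lia.
  + by move=> c /in3 [] ->; [exists p.+2|exists p|exists p.+1];
      rewrite ?E0 ?E1 //; lia.
  + by rewrite !big_nat_recr ?big_geq ?E0 ?E1 ?E2 //=; lia.
- apply: (block p.+3 [:: p; p.+1]) => //; try lia.
  + by apply: bas_su; lia.
  + by move=> i; rewrite !inE; lia.
  + by move=> j /in3 [] -> /=; rewrite /simple_act; repeat (case: ifP => ?; try lia);
      rewrite ?E0 ?E1 ?E2 Lp //; lia.
  + by move=> c /in3 [] ->; [exists p.+1|exists p.+2|exists p];
      rewrite ?E0 ?E1 //; lia.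
  + by rewrite !big_nat_recr ?big_geq ?E0 ?E1 ?E2 //=; lia.
- apply: (block p.+3 [:: p; p.+1; p]) => //; try lia.
  + by apply: bas_sus; lia.
  + by move=> i; rewrite !inE; lia.
  + by move=> j /in3 [] -> /=; rewrite /simple_act; repeat (case: ifP => ?; try lia);
      rewrite ?E0 ?E1 ?E2 Lp //; lia.
  + by move=> c /in3 [] ->; [exists p.+2|exists p.+1|exists p];
      rewrite ?E0 ?E1 //; lia.
  + by rewrite !big_nat_recr ?big_geq ?E0 ?E1 ?E2 //=; lia.
- apply: (block p.+4 [:: p; p.+2; p.+1]) => //; try lia.
  + by apply: bas_stu; lia.
  + by move=> i; rewrite !inE; lia.
  + by move=> j /in4 [] -> /=; rewrite /simple_act; repeat (case: ifP => ?; try lia);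
      rewrite ?E0 ?E1 ?E2 ?E3 Lp //; lia.
  + by move=> c /in4 [] ->; [exists p.+1|exists p.+3|exists p|exists p.+2];
      rewrite ?E0 ?E1 //; lia.
  + by rewrite !big_nat_recr ?big_geq ?E0 ?E1 ?E2 ?E3 //=; lia.
Qed.

End Necessity.

(** * Decomposition into separated blocks *)

Section Conclusion.
Variable r : nat.
Implicit Types (X : nat -> int) (p q : nat).

(** Letters that differ by at least 2 belong to orthogonal simple roots, hence
    to distinct commuting reflections. *)
Definition separated (u v : seq nat) := allrel (fun i j => i.+2 <= j)%N u v.

(** Blocks are split off from the left; a word only uses letters before the last
    position of its block, and the next words only letters after it, whence
    the separation. *)
Lemma small_deficit_decomposition p X : (1 < p)%N -> small_deficit r p X ->
  (forall j, (0 < j < p)%N -> X j = highest_rho_coord r j) ->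
  exists ws : seq (seq nat), [/\ forall w, w \in ws -> basic_allowable r w,
    all (all (leq p)) ws, pairwise separated ws &
    vec r X = word_elt r (flatten ws) *m vec r (highest_rho_coord r)].
Proof.
have [n] := ubnP (r.+1 - p); elim: n => // n IH in p X * => pn p2 hX hd.
have [rp|pr] := ltnP r p.
  exists [::]; split=> //=; rewrite /word_elt big_nil mul1mx.
  by apply: eq_vec => j jr; apply: hd; lia.
have [w [q [bw pq wpq hq wX]]] := first_block p2 pr hX hd.
have [||j jq|ws [bws qws sws Ews]] := IH q (reset_below r q X) _ _ hq; [lia|lia| |].
  by rewrite /reset_below ifT; lia.
exists (w :: ws); split=> [v|||] /=.
- by rewrite inE => /orP [/eqP ->|/bws].
- apply/andP; split; first by apply/allP => i /wpq /andP[].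
  by apply: sub_all qws => v; apply: sub_all => i; apply: leq_trans; lia.
- rewrite sws andbT; apply/allP => v vws; apply/allrelP => i j iw jv.
  by have /allP/(_ _ jv) := allP qws v vws; have := wpq i iw; lia.
- rewrite word_elt_cat -mulmxA -Ews word_elt_vec ?basic_allowable_valid //.
  by apply: eq_vec => j jr; rewrite wX.
Qed.

Lemma weyl_orbit_coord sigma : (0 < r)%N -> weyl sigma -> exists X,
  [/\ sigma *m (highest_root r + rho r) = vec r X,
    forall j, (0 < j <= r)%N ->
      exists2 k, (0 < k <= r)%N & `|X j|%N = `|highest_rho_coord r k|%N &
    forall j k, (0 < j)%N -> (j < k)%N -> (k <= r)%N -> `|X j|%N <> `|X k|%N].
Proof.
move=> r0 /weyl_word [w rw ->]; have [p [e [pr pinj e1 ew]]] := word_act_signed rw.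
exists (word_act r w (highest_rho_coord r)).
have H j : (0 < j <= r)%N ->
    `|word_act r w (highest_rho_coord r) j|%N = `|highest_rho_coord r (p j)|%N.
  by move=> jr; rewrite ew //; case: (e1 j) => ->; lia.
split; first by rewrite highest_rho_vec // word_elt_vec.
  by move=> j jr; exists (p j); [exact: pr|exact: H].
move=> j k j0 jk kr; have jr : (0 < j <= r)%N by lia.
have kr' : (0 < k <= r)%N by lia.
rewrite !H // => E; have := pinj j k jr kr'; have := pr j jr; have := pr k kr'.
by move: E; rewrite /highest_rho_coord /rho_coord; do !case: eqP; lia.
Qed.

(** The coordinates of highest_root + rho are positive and distinct, so that
    no signed permutation but the identity fixes this vector. *)
Lemma weyl_regular sigma : (0 < r)%N -> weyl sigma ->
  sigma *m (highest_root r + rho r) = highest_root r + rho r -> sigma = 1%:M.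
Proof.
move=> r0 /weyl_word [w rw ->]; have [p [e [pr pinj e1 ew]]] := word_act_signed rw.
rewrite highest_rho_vec // word_elt_vec // => /vec_inj H.
have pe j : (0 < j <= r)%N -> p j = j /\ e j = 1.
  move=> jr; have := H j jr; rewrite ew //; have := pr j jr.
  rewrite /highest_rho_coord /rho_coord.
  by case: (e1 j) => ->; do !case: eqP => *; split=> //; lia.
apply/matrixP => i j.
have := word_elt_vec (fun k => Posz (k == j.+1)) rw.
have -> : vec r (word_act r w (fun k => Posz (k == j.+1))) =
    vec r (fun k => Posz (k == j.+1)).
  by apply: eq_vec => k kr; rewrite ew //; have [-> ->] := pe k kr; rewrite mul1r.
have -> : vec r (fun k => Posz (k == j.+1)) = delta_mx j 0.
  by apply/matrixP => a b; rewrite !mxE ord1 eqSS -val_eqE /= andbT; case: (_ == _).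
by rewrite -colE => /matrixP/(_ i 0); rewrite !mxE andbT.
Qed.

Lemma weyl_inj sigma tau : (0 < r)%N -> weyl sigma -> weyl tau ->
  sigma *m (highest_root r + rho r) = tau *m (highest_root r + rho r) -> sigma = tau.
Proof.
move=> r0 ws wt E; have [w rw Et] := weyl_word wt.
have K := word_elt_revK rw; have [_ U] := mulmx1_unit K; rewrite -Et in U.
have : invmx tau *m sigma = 1%:M.
  apply: weyl_regular => //; first by apply: weyl_mul => //; apply: weyl_inv.
  by rewrite -mulmxA E mulKmx.
by move/(congr1 (mulmx tau)); rewrite mulKVmx // mulmx1.
Qed.

Lemma word_elt_weyl w : valid_word r w -> weyl (word_elt r w).
Proof.
elim: w => [|i w IH] /=; first by rewrite /word_elt big_nil => _; apply: weyl_one.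
case/andP=> ir /IH; rewrite word_elt_cons; apply: weyl_mul.
exact: weyl_gen.
Qed.

(** The first coordinate of the image must be at least r, which only r + 2 is;
    this leaves a margin of 2 for all later partial sums. *)
Lemma kostant_gt0_small_deficit sigma : (2 <= r)%N -> weyl sigma ->
  (0 < kostant (sigma *m (highest_root r + rho r) - rho r))%N ->
  exists X, [/\ sigma *m (highest_root r + rho r) = vec r X,
    small_deficit r 2 X & forall j, (0 < j < 2)%N -> X j = highest_rho_coord r j].
Proof.
move=> r2 wsigma; have r0 : (0 < r)%N by lia.
have [X [EX abs dX]] := weyl_orbit_coord r0 wsigma.
rewrite EX rho_vec -vecB => kX.
have s k : (k <= r)%N -> 0 <= \sum_(1 <= j < k.+1) (X j - rho_coord r j).
  by move=> kr; exact: (kostant_gt0_partial_sum kr kX).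
have X1 : X 1%N = highest_rho_coord r 1%N.
  have := s 1%N r0; rewrite big_nat1; have [|k kr] := abs 1%N; first by lia.
  have [->|k1] := eqVneq k 1%N; rewrite highest_rho_coord1.
    by rewrite /rho_coord; lia.
  by rewrite highest_rho_coord_gt1 /rho_coord; lia.
exists X; split=> //; last by move=> j j1; have -> : j = 1%N by lia.
split.
- move=> j jr; have [|k kr Ek] := abs j; first by lia.
  have := dX 1%N j; rewrite X1 Ek highest_rho_coord1.
  have [->|k1] := eqVneq k 1%N; first by rewrite highest_rho_coord1; lia.
  by rewrite highest_rho_coord_gt1 /rho_coord; lia.
- by move=> j k j2 jk kr; apply: dX => //; lia.
- move=> k /andP[k2 kr]; have := s k kr; rewrite big_ltn ?X1; last by lia.
  rewrite highest_rho_coord1 /(rho_coord r 1%N).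
  have -> : \sum_(2 <= j < k.+1) (rho_coord r j - X j) =
            - \sum_(2 <= j < k.+1) (X j - rho_coord r j).
    by rewrite -sumrN; apply: eq_bigr => j _; rewrite opprB.
  by move: (\sum_(2 <= j < _) _) => S; lia.
Qed.

Lemma separated_commuting_words u v : valid_word r u -> valid_word r v ->
  separated u v -> commuting_words r u v /\ commuting_words r v u.
Proof.
move=> ru rv /allrelP uv.
have orth i j : i \in u -> j \in v -> dot (simple_root r i) (simple_root r j) = 0.
  move=> iu jv; apply: dot_simple_roots; [exact: (allP ru)|exact: (allP rv)|exact: uv].
split=> i j iu jv; apply: orthogonal_reflections.
- by apply: simple_root_neq0; apply: (allP ru).
- exact: orth.
- by apply: simple_root_neq0; apply: (allP rv).
- by rewrite dotC orth.
Qed.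

Lemma separated_commuting_product ws :
  (forall w, w \in ws -> basic_allowable r w) -> pairwise separated ws ->
  commuting_bas_product (word_elt r (flatten ws)).
Proof.
(* The empty word is added so that there is at least one factor. *)
move=> bws sws; exists (size ws).+1, (fun a => nth [::] ([::] :: ws) a).
have bw n : basic_allowable r (nth [::] ([::] :: ws) n).
  have [ns|ns] := ltnP n (size ([::] :: ws));
    last by rewrite nth_default //; exact: bas_id.
  by have := mem_nth [::] ns; rewrite inE => /orP [/eqP ->|/bws //]; exact: bas_id.
split=> //.
- move=> a b ab.
  have sws' : pairwise separated ([::] :: ws).
    by rewrite /= sws andbT; apply/allP => v _; apply/allrelP.
  have sep m n : (m < n < (size ws).+1)%N ->
      separated (nth [::] ([::] :: ws) m) (nth [::] ([::] :: ws) n).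
    case/andP=> mn nk; apply: (pairwiseP [::] sws') => //.
    exact: ltn_trans mn nk.
  have L n := basic_allowable_valid (bw n).
  have [lt|lt|/val_inj E] := ltngtP a b; last by rewrite E eqxx in ab.
    have Sab : separated (nth [::] ([::] :: ws) a) (nth [::] ([::] :: ws) b).
      by apply: sep; rewrite lt ltn_ord.
    by have [] := separated_commuting_words (L a) (L b) Sab.
  have Sba : separated (nth [::] ([::] :: ws) b) (nth [::] ([::] :: ws) a).
    by apply: sep; rewrite lt ltn_ord.
  by have [] := separated_commuting_words (L b) (L a) Sba.
- rewrite big_ord_recl /= [X in X *m _]/word_elt big_nil mul1mx.
  transitivity (\big[mulmx/1%:M]_(w <- ws) word_elt r w);
    last by rewrite (big_nth [::]) big_mkord.
  elim: ws {bws sws bw} => [|w ws IH] /=; first by rewrite big_nil /word_elt big_nil.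
  by rewrite big_cons word_elt_cat IH.
Qed.

End Conclusion.

Theorem theorem5p5 (r : nat) (hr : (2 <= r)%N)
    (sigma : 'M[rat]_r) (hsigma : weyl sigma) :
  weyl_alternation_set sigma <-> commuting_bas_product sigma.
Proof.
have r0 : (0 < r)%N by lia.
split=> [[_ ks]|cs]; last first.
  by split=> //; apply: commuting_product_kostant_gt0.
have [X [EX hX hd]] := kostant_gt0_small_deficit hr hsigma ks.
have [//|ws [bws _ sws Ews]] := small_deficit_decomposition _ hX hd.
have -> : sigma = word_elt r (flatten ws).
  apply: weyl_inj => //; last by rewrite EX Ews highest_rho_vec.
  apply: word_elt_weyl; apply/allP => i /flattenP [w /bws /basic_allowable_valid rw].
  exact: (allP rw).
exact: separated_commuting_product.
Qed.
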